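(* Let $\mathcal I$ be an ideal on $\omega^\omega$ such that ${\rm cof}(\mathcal I) \leq \mathfrak{c}$ (where $\mathfrak c = 2^{\aleph_0}$) and $|\omega^\omega \setminus X| = \mathfrak{c}$ for every $X \in \mathcal I$. Then $\mathfrak{d}(R_\mathcal I) = \mathfrak{d}(R_{\{\emptyset\}})$ for all $R \in \{\in^*, \leq^*, \neq^*\}$, where $\{\emptyset\}$ is the trivial ideal consisting only of the empty set.
   Context: A slalom is a function $s:\omega \to [\omega]^{<\omega}$ with $|s(n)| \le n$ for all $n$; $\mathcal S$ is the set of slaloms. For $x,y\in\omega^\omega$, $s \in \mathcal S$: $x \leq^* y$ iff $x(k)\le y(k)$ for all but finitely many $k$; $x \neq^* y$ iff $x(k)\neq y(k)$ for all but finitely many $k$; $x \in^* s$ iff $x(k)\in s(k)$ for all but finitely many $k$. For an ideal $\mathcal I$ on $\omega^\omega$ and $f:\omega^\omega\to\omega^\omega$, $g:\omega^\omega\to\omega^\omega$ (or $g:\omega^\omega\to\mathcal S$ when $R=\in^*$), $f R_\mathcal I g$ iff $\{x : \neg(f(x) R g(x))\} \in \mathcal I$ (so $f R_{\{\emptyset\}} g$ means $f(x) R g(x)$ for every $x$). $\mathfrak d(R_\mathcal I)$ is the least size of a family $D$ of functions $g$ (of the appropriate type) such that for every $f:\omega^\omega\to\omega^\omega$ there is $g \in D$ with $f R_\mathcal I g$. ${\rm cof}(\mathcal I)$ is the least size of a subfamily of $\mathcal I$ cofinal under inclusion. *)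

(* Defs.v *)
From mathcomp Require Import all_boot finmap.
From mathcomp Require Import boolp classical_sets functions cardinality.

Set Implicit Arguments.
Unset Strict Implicit.
Unset Printing Implicit Defensive.

Local Open Scope classical_set_scope.
Local Open Scope card_scope.

Definition baire : Type := nat -> nat.

Definition slalom : Type :=
  {s : nat -> {fset nat} | forall n, (#|` s n| <= n)%N}.

Definition almost_all (P : nat -> Prop) : Prop := finite_set [set k | ~ P k].

Definition le_star (x y : baire) : Prop := almost_all (fun k => (x k <= y k)%N).

Definition neq_star (x y : baire) : Prop := almost_all (fun k => x k <> y k).

Definition in_star (x : baire) (s : slalom) : Prop :=
  almost_all (fun k => x k \in sval s k).

(* Properness is not part of the definition, and neither is containing the
   singletons, so that [set set0] is an ideal. *)
Record is_ideal (T : Type) (I : set (set T)) : Prop := IsIdeal {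
  ideal0 : I set0;
  idealS : forall X Y, X `<=` Y -> I Y -> I X;
  idealU : forall X Y, I X -> I Y -> I (X `|` Y) }.

Definition is_least_card (U : Type) (F : set (set U)) (D : set U) : Prop :=
  F D /\ forall E, F E -> D #<= E.

(* A cardinal is represented by a set of that size, to be compared with #<= and
   #= only: [least_card F] is a chosen member of F of least size. It exists
   whenever F is nonempty, see [least_cardP]; the default is set0 otherwise. *)
Definition least_card (U : Type) (F : set (set U)) : set U :=
  xget set0 (is_least_card F).

Definition continuum : set (nat -> bool) := [set: nat -> bool].

Definition rel_mod (T : Type) (R : baire -> T -> Prop) (I : set (set baire))
    (f : baire -> baire) (g : baire -> T) : Prop :=
  I [set x | ~ R (f x) (g x)].

Definition dominating (T : Type) (R : baire -> T -> Prop)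
    (I : set (set baire)) : set (set (baire -> T)) :=
  [set D | forall f : baire -> baire, exists2 g, D g & rel_mod R I f g].

Definition dnum (T : Type) (R : baire -> T -> Prop) (I : set (set baire)) :
  set (baire -> T) := least_card (dominating R I).

Definition cofinal_in (T : Type) (I : set (set T)) : set (set (set T)) :=
  [set J | J `<=` I /\ forall X, I X -> exists2 Y, J Y & X `<=` Y].

Definition cof (T : Type) (I : set (set T)) : set (set T) :=
  least_card (cofinal_in I).

Definition trivial_ideal (T : Type) : set (set T) := [set set0].
Arguments trivial_ideal T : clear implicits.

Lemma ex_least_card (U : Type) (F : set (set U)) :
  F !=set0 -> exists D, is_least_card F D.
Proof.
move=> [A0 FA0].
pose P (S : set (set U -> U)) :=
  (forall h, S h -> forall A, F A -> A (h A)) /\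
  (forall h h' A, S h -> S h' -> F A -> h A = h' A -> h = h').
have [|S [[S1 S2] Smax]] := @Zorn_bigcup _ P.
  move=> G GP Gtot; split=> [h [S GS Sh]|h h' A [S GS Sh] [S' GS' Sh'] FA].
    by have [+ _] := GP _ GS; apply.
  have [SS'|S'S] := Gtot _ _ GS GS'.
    by have [_ /(_ h h' A)] := GP _ GS'; apply => //; exact: SS'.
  by have [_ /(_ h h' A)] := GP _ GS; apply => //; exact: S'S.
have [D [FD Donto]] : exists D, F D /\ forall a, D a -> exists2 h, S h & h D = a.
  apply: contrapT => nD.
  have miss A : F A -> exists a, A a /\ forall h, S h -> h A <> a.
    move=> FA; apply: contrapT => nA; apply: nD; exists A; split=> // a Aa.
    apply: contrapT => na; apply: nA; exists a; split=> // h Sh hA.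
    by apply: na; exists h.
  have [a0 _] := miss _ FA0.
  have /choice[h hP] A : exists a, F A -> A a /\ forall k, S k -> k A <> a.
    have [/miss[a aP]|nFA] := pselect (F A); first by exists a.
    by exists a0.
  apply: (Smax (h |` S)).
    split; first exact: subsetUr.
    move=> /(_ h (or_introl erefl)) Sh.
    by have [_ /(_ _ Sh)] := hP _ FA0.
  split=> [k [->|Sk] A FA|k k' A [->|Sk] [->|Sk'] FA] //.
  - by have [] := hP _ FA.
  - by apply: (S1 _ Sk).
  - by move=> /esym; have [_ /(_ _ Sk')] := hP _ FA.
  - by have [_ /(_ _ Sk)] := hP _ FA.
  - exact: S2 FA.
exists D; split=> // E FE.
have [->|/set0P[a0 Da0]] := eqVneq D set0; first exact: subset_card_le.
have [h0 _ _] := Donto _ Da0.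
have /choice[h hP] a : exists h, D a -> S h /\ h D = a.
  by have [/Donto[h]|] := pselect (D a); [exists h | exists h0].
have hinj : {in D &, injective (fun a => h a E)}.
  move=> a b /set_mem /hP[Sa ha] /set_mem /hP[Sb hb] hab.
  by rewrite -ha -hb (S2 _ _ _ Sa Sb FE hab).
rewrite -(card_le_eql (inj_card_eq hinj)).
apply: subset_card_le => _ [a Da <-]; have [Sa _] := hP _ Da; exact: (S1 _ Sa).
Qed.

Lemma least_cardP (U : Type) (F : set (set U)) :
  F !=set0 -> is_least_card F (least_card F).
Proof. by move=> /ex_least_card; exact: xgetPex. Qed.

Lemma dnumP (T : Type) (R : baire -> T -> Prop) (I : set (set baire)) :
    is_ideal I -> (forall x, exists y, R x y) ->
  is_least_card (dominating R I) (dnum R I).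
Proof.
move=> [I0 _ _] /choice[r rP]; apply: least_cardP; exists setT => f.
exists (r \o f) => //; rewrite /rel_mod (_ : [set _ | _] = set0) //.
by apply/seteqP; split=> x //=; apply.
Qed.

Lemma cofP (T : Type) (I : set (set T)) : is_least_card (cofinal_in I) (cof I).
Proof. by apply: least_cardP; exists I; split=> // X IX; exists X. Qed.

Lemma le_star_ex (x : baire) : exists y, le_star x y.
Proof.
exists x; rewrite /le_star /almost_all (_ : [set _ | _] = set0) //.
by apply/seteqP; split=> k //=; apply.
Qed.

Lemma neq_star_ex (x : baire) : exists y, neq_star x y.
Proof.
exists (fun k => (x k).+1); rewrite /neq_star /almost_all.
rewrite (_ : [set _ | _] = set0) //; apply/seteqP; split=> k //=; apply.
Qed.

Lemma in_star_ex (x : baire) : exists s, in_star x s.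
Proof.
pose s n : {fset nat} := if n is 0 then fset0 else [fset x n]%fset.
have sP n : (#|` s n| <= n)%N.
  by case: n => [|n]; rewrite /s ?cardfs0 ?cardfs1.
exists (exist _ s sP); apply: (@sub_finite_set _ _ [set 0%N]) => //.
by case=> [|n] //=; rewrite fset11 => /(_ isT).
Qed.

Lemma trivial_is_ideal (T : Type) : is_ideal (trivial_ideal T).
Proof.
split=> // [X Y|X Y -> ->]; last by rewrite /trivial_ideal /= setU0.
by move=> + YE; rewrite YE subset0.
Qed.

(* Main.v *)
(** Only [d(R_I) >= d(R_{0})] needs an argument. Recursion along a well-order
    of length continuum, with a cofinal family of [I] of size at most the
    continuum, yields a map [phi] onto the continuum none of whose fibers is
    contained in a member of [I]. Diagonalizing along the fibers shows that an
    [R_I]-dominating family [D] has at least continuum many members. Given [f],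
    some [g] in [D] captures [f \o phi] off a set of [I], which lies in a member
    [Y] of the cofinal family; reading [g] at a point of each fiber outside [Y]
    captures [f] everywhere. The resulting family is indexed by the pairs
    [(g, Y)], hence is no larger than [D]. *)

Require Import Defs.
From mathcomp Require Import all_boot finmap.
From mathcomp Require Import boolp classical_sets functions cardinality.
From mathcomp Require Import wochoice.

Local Open Scope classical_set_scope.
Local Open Scope card_scope.

(** * Comparison of cardinals through injections *)

Lemma inj_on_card_le {T U : Type} {A : set T} {B : set U} (f : T -> U) :
  {in A &, injective f} -> (forall a, A a -> B (f a)) -> A #<= B.
Proof.
move=> finj fAB; rewrite -(card_le_eql (inj_card_eq finj)).
by apply: subset_card_le => _ [a Aa <-]; exact: fAB.
Qed.

Lemma card_le_inj_on {T U : Type} {A : set T} {B : set U} (u0 : U) :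
  A #<= B -> exists2 f : T -> U,
    {in A &, injective f} & forall a, A a -> B (f a).
Proof.
move=> /card_leP[f].
pose g a :=
  if pselect (A a) is left Aa then val (f (SigSub (mem_set Aa))) else u0.
exists g => [a b /set_mem Aa /set_mem Ab|a Aa]; rewrite /g.
  case: pselect => // Aa'; case: pselect => // Ab' /val_inj fab.
  by have [] := @inj _ _ _ f _ _ (in_setT _) (in_setT _) fab.
by case: pselect => // Aa'; exact: set_valP.
Qed.

(** Least cardinality makes sense for sets in one type, so [A] and [B] are copied into the sum type;
    whichever copy is least decides the case. *)
Lemma card_le_total {T U : Type} (A : set T) (B : set U) : A #<= B \/ B #<= A.
Proof.
pose A' := @inl T U @` A; pose B' := @inr T U @` B.
have AA' : A' #= A by apply: inj_card_eq => x y _ _ [].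
have BB' : B' #= B by apply: inj_card_eq => x y _ _ [].
have [|D [FD Dmin]] := @ex_least_card _ [set A'; B'].
  by exists A'; left.
have A'D := Dmin A' (or_introl erefl); have B'D := Dmin B' (or_intror erefl).
case: FD => DE; rewrite DE in A'D B'D.
  by left; rewrite -(card_le_eql AA') -(card_le_eqr BB').
by right; rewrite -(card_le_eql BB') -(card_le_eqr AA').
Qed.

(** * Initial well-orders and recursion along them *)

(** If a well-order has an initial segment as large as [C], take the least [m] bounding one and pull
    the order back along an injection of [C] into the segment below [m]. *)
Lemma initial_well_order (C : choiceType) : exists lt : C -> C -> Prop,
  [/\ well_founded lt, forall i j, [\/ lt i j, i = j | lt j i] &
      forall k, ~ ([set: C] #<= [set j | lt j k])].
Proof.
have [R Rwo] := well_ordering_principle C.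
pose lt i j := ~~ R j i.
have ltwf : well_founded lt.
  move=> a; apply: contrapT => nAcc.
  have [|z [[/asboolP nz zmin] _]] := Rwo (fun x => `[< ~ Acc lt x >]).
    by exists a; apply/asboolP.
  apply: nz; constructor=> y; rewrite /lt => nRzy; apply: contrapT => nAy.
  by move: nRzy; rewrite zmin //; apply/asboolP.
have lttri i j : [\/ lt i j, i = j | lt j i].
  rewrite /lt; case Rij: (R i j); last by apply: Or33.
  case Rji: (R j i); last by apply: Or31.
  apply: Or32; have [|z [_ zu]] := Rwo (pred2 i j).
    by exists i; rewrite inE eqxx.
  have rfl x : R x x.
    have [|w [[/eqP-> +] _]] := Rwo (pred1 x); first by exists x; rewrite inE.
    by apply; rewrite inE.
  rewrite -(zu i) 1?(zu j) //; split; rewrite ?inE ?eqxx ?orbT // => x.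
    by rewrite inE => /orP[]/eqP->.
  by rewrite inE => /orP[]/eqP->.
have [all_small|/existsNP[k0 /contrapT big0]] :=
    pselect (forall k, ~ ([set: C] #<= [set j | lt j k])); first by exists lt.
have [|m [[/asboolP mbig mmin] _]] :=
    Rwo (fun k => `[< [set: C] #<= [set j | lt j k] >]).
  by exists k0; apply/asboolP.
have [h hinj hm] := card_le_inj_on k0 mbig.
exists (fun i j => lt (h i) (h j)); split.
- move=> i; move: {2}(h i) (erefl (h i)) => a.
  elim/(well_founded_ind ltwf): a i => a IH i hi; constructor=> j.
  by rewrite hi => /IH; apply.
- move=> i j; have [|/hinj e|] := lttri (h i) (h j).
  + exact: Or31.
  + by apply: Or32; apply: e; rewrite in_setT.
  + exact: Or33.
(* The segment below [k] injects by [h] into the one below [h k], and [h k] lies before [m], against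
   the minimality of [m]. *)
- move=> k kbig; have /= := hm k I; rewrite /lt mmin //; apply/asboolP.
  apply: card_le_trans kbig _; apply: (inj_on_card_le h) => // i j _ _.
  by apply: hinj; rewrite in_setT.
Qed.

(** Transfinite recursion: the values used before stage [k] are fewer than the elements of [C], so
    [A k] still has a fresh one. *)
Lemma injective_selector (C : choiceType) (U : choiceType) (A : C -> set U) :
  (forall k, [set: C] #<= A k) ->
  exists2 z : C -> U, injective z & forall k, A k (z k).
Proof.
move=> bigA; have [lt [ltwf lttri ltsmall]] := initial_well_order C.
have [[k0 _]|C0] := pselect (exists k : C, True); last first.
  have z (k : C) : U by case: C0; exists k.
  by exists z => [i|k]; case: C0; [exists i|exists k].
have [u0 _] : exists u, A k0 u.
  have /card_leP[f] := bigA k0.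
  by exists (val (f (SigSub (in_setT k0)))); exact: set_valP.
(* The default [u0] only makes the recursion total; [zP] shows that a fresh value always exists. *)
pose F k (zk : forall j, lt j k -> U) :=
  xget u0 [set u | A k u /\ forall j (jk : lt j k), zk j jk <> u].
pose z := Fix ltwf (fun=> U) F.
have zE k : z k = F k (fun j _ => z j).
  apply: (@Fix_eq _ _ ltwf (fun=> U) F) => x f g fg; congr (F x _).
  apply: functional_extensionality_dep => y.
  exact: functional_extensionality_dep.
have zP k : A k (z k) /\ forall j, lt j k -> z j <> z k.
  rewrite [z k]zE /F; set P := [set u | _].
  suff: P (xget u0 P) by [].
  apply: xgetPex; apply: contrapT => nP; apply: (ltsmall k).
  apply: card_le_trans (bigA k) _.
  apply: card_le_trans (card_image_le z [set j | lt j k]).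
  apply: subset_card_le => u Aku; apply: contrapT => nu.
  by apply: nP; exists u; split=> // j jk zju; apply: nu; exists j.
exists z => [i j zij|k]; last by have [] := zP k.
have [ij|//|ji] := lttri i j.
  by have [_ /(_ _ ij)] := zP j.
by have [_ /(_ _ ji)] := zP i; rewrite zij.
Qed.

(** * Coding into the continuum *)

(** The leading bit lets [card_mul_continuum] tell the remainder from the copy that absorbs it. *)
Definition interleave (b : bool) (u v : nat -> bool) (n : nat) : bool :=
  if n is m.+1 then (if odd m then u m./2 else v m./2) else b.

Lemma interleave_inj b u v b' u' v' :
  interleave b u v = interleave b' u' v' -> [/\ b = b', u = u' & v = v'].
Proof.
move=> E; split; first exact: (congr1 (@^~ 0) E).
- apply/funext => n; have := congr1 (@^~ (n.*2.+2)) E.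
  by rewrite /interleave /= odd_double /= uphalf_double.
- apply/funext => n; have := congr1 (@^~ (n.*2.+1)) E.
  by rewrite /interleave odd_double doubleK.
Qed.

(** A function is determined by its graph, coded as a subset of [nat] through [pickle]. *)
Lemma baire_card_le_continuum : [set: baire] #<= continuum.
Proof.
pose graph (x : baire) n : bool :=
  if (choice.unpickle n : option (nat * nat)) is Some (i, j)
  then x i == j else false.
apply: (inj_on_card_le graph).
  move=> x y _ _ E; apply/funext => i.
  have := congr1 (@^~ (choice.pickle (i, x i))) E.
  by rewrite /graph choice.pickleK eqxx => /esym/eqP.
by [].
Qed.

(* A maximal family of disjoint copies of the continuum inside [D] leaves a
   remainder smaller than the continuum, so [D] is absorbed by a multiple of
   the continuum. *)
Lemma card_mul_continuum {U : Type} {D : set U} : continuum #<= D ->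
  D `*` continuum #<= D.
Proof.
move=> cD; have [u0 Du0] : exists u, D u.
  have /card_leP[f] := cD.
  by exists (val (f (SigSub (in_setT (fun=> true))))); exact: set_valP.
pose P (S : set ((nat -> bool) -> U)) :=
  (forall s, S s -> forall c, D (s c)) /\
  (forall s s' c c', S s -> S s' -> s c = s' c' -> s = s' /\ c = c').
have [|S [[S1 S2] Smax]] := @Zorn_bigcup _ P.
  move=> G GP Gtot; split=> [s [S GS Ss]|s s' c c' [S GS Ss] [S' GS' Ss']].
    by have [+ _] := GP _ GS; apply.
  have [SS'|S'S] := Gtot _ _ GS GS'.
    by have [_] := GP _ GS'; apply => //; exact: SS'.
  by have [_] := GP _ GS; apply => //; exact: S'S.
pose rest := [set d | D d /\ forall s c, S s -> s c <> d].
have nrest : ~ (continuum #<= rest).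
  move=> /(card_le_inj_on u0)[t tinj trest].
  apply: (Smax (t |` S)).
    split; first exact: subsetUr.
    move=> /(_ t (or_introl erefl)) St.
    by have [_ /(_ t (fun=> true) St)] := trest (fun=> true) Logic.I.
  split=> [s [->|Ss] c|s s' c c' [->|Ss] [->|Ss']].
  - by have [] := trest c Logic.I.
  - exact: S1.
  - by move=> /tinj->; rewrite ?in_setT.
  - by move=> /esym; have [_ /(_ s' c' Ss')] := trest c Logic.I.
  - by have [_ /(_ s c Ss)] := trest c' Logic.I.
  - exact: S2.
have [s0 Ss0] : exists s, S s.
  apply: contrapT => S0; apply: nrest; apply: card_le_trans cD _.
  by apply: subset_card_le => d Dd; split=> // s c Ss; case: S0; exists s.
have [//|/(card_le_inj_on (fun=> true))[j jinj _]] :=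
  card_le_total continuum rest.
(* Coordinates for [d]: the copy and position holding it or, in the remainder, a place in the fixed
   copy [s0] found through [j]. *)
have /choice[q qP] d : exists q : ((nat -> bool) -> U) * (nat -> bool),
    D d -> (S q.1 /\ q.1 q.2 = d) \/ (rest d /\ q.1 = s0 /\ q.2 = j d).
  have [[s [c [Ss sc]]]|nd] := pselect (exists s c, S s /\ s c = d).
    by exists (s, c); left.
  exists (s0, j d) => Dd; right; split=> //; split=> // s c Ss sc.
  by apply: nd; exists s, c.
pose b d : bool := `[< rest d >].
have qS d : D d -> S (q d).1 by move=> /qP[[]|[_ [-> _]]].
(* The new position, in the copy assigned to [d], records [v], the old place of [d], and whether [d]
   came from the remainder. *)
apply: (inj_on_card_le (fun p => (q p.1).1 (interleave (b p.1) (q p.1).2 p.2))).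
  move=> [d v] [d' v'] /set_mem[/= Dd _] /set_mem[/= Dd' _].
  move=> /(S2 _ _ _ _ (qS _ Dd) (qS _ Dd'))[q1 /interleave_inj[bE q2 ->]].
  congr pair; move: bE; rewrite /b.
  have [[Sd qd]|[rd [_ qd]]] := qP _ Dd;
    have [[Sd' qd']|[rd' [_ qd']]] := qP _ Dd'.
  - by rewrite -qd -qd' q1 q2.
  - rewrite [RHS]asboolT // => /asboolP[_ /(_ _ (q d).2 Sd)]; by case.
  - rewrite [LHS]asboolT // => /esym/asboolP[_ /(_ _ (q d').2 Sd')]; by case.
  - by move=> _; apply: jinj; rewrite ?inE // -qd -qd'.
by move=> [d v] [/= Dd _]; apply/S1/qS.
Qed.

(** * Transfer from [I] to the trivial ideal *)

Section Ideal.
Context {I : set (set baire)} (I_ideal : is_ideal I).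
Context (cof_le : cof I #<= continuum).
Context (compl_card : forall X : set baire, I X -> (~` X) #= continuum).

Lemma cofinal_enum : exists2 e : (nat -> bool) -> set baire,
  forall c, I (e c) & forall X, I X -> exists c, X `<=` e c.
Proof.
have [[JI Jcof] _] := cofP I.
have [j jinj _] := card_le_inj_on (fun=> true) cof_le.
have /choice[e eP] c : exists Y, I Y /\ forall Z, cof I Z -> j Z = c -> Y = Z.
  have [[Z [JZ <-]]|nZ] := pselect (exists Z, cof I Z /\ j Z = c).
    exists Z; split=> [|Z' JZ' /jinj->]; rewrite ?inE //; exact: JI.
  (* Codes outside the range of [j] get the empty set, which keeps every [e c] in [I]. *)
  exists set0; split=> [|Z JZ jZ]; first exact: ideal0.
  by case: nZ; exists Z.
exists e => [c|X IX]; first by have [] := eP c.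
have [Y JY XY] := Jcof _ IX; exists (j Y).
by have [_ /(_ _ JY erefl)->] := eP (j Y).
Qed.

(** For each pair [(a, c)] a point outside [e a], distinct for distinct pairs, receives the value
    [c]. A set in [I] lies in some [e a], so over every [c] it misses such a point. *)
Lemma large_fibers : exists phi : baire -> nat -> bool,
  forall X, I X -> forall c, exists2 z, ~ X z & phi z = c.
Proof.
have [e eI ecof] := cofinal_enum.
pose p (ab : (nat -> bool) * (nat -> bool)) := interleave true ab.1 ab.2.
have pinj : injective p.
  by move=> [a b] [a' b'] /interleave_inj[_ /= -> ->].
(* Decoding pairs by [q] lets the selector be indexed by the continuum itself, to which the
   complements are compared. *)
have /choice[q qP] c : exists q, forall ab, p ab = c -> q = ab.
  have [[ab <-]|n] := pselect (exists ab, p ab = c).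
    by exists ab => ? /pinj.
  by exists (fun=> true, fun=> true) => ab abc; case: n; exists ab.
have qp ab : q (p ab) = ab by exact: qP.
have [|z zinj zP] := @injective_selector _ _ (fun c => ~` e (q c).1).
  by move=> c; move: (compl_card _ (eI (q c).1)); rewrite card_eq_le => /andP[].
have /choice[phi phiP] x : exists d, forall c, z c = x -> d = (q c).2.
  have [[c <-]|n] := pselect (exists c, z c = x).
    by exists (q c).2 => ? /zinj->.
  by exists (fun=> true) => c zc; case: n; exists c.
exists phi => X IX c; have [a Xa] := ecof _ IX.
exists (z (p (a, c))); last by rewrite (phiP _ _ erefl) qp.
by move=> /Xa; have := zP (p (a, c)); rewrite qp.
Qed.

Context {T : Type} {R : baire -> T -> Prop}.
Context (R_total : forall x, exists y, R x y).
Context (R_evade : forall y, exists x, ~ R x y).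

(** Were [D] no larger than the continuum, some [f] would evade each [g] in [D] all along the fiber
    of [phi] over the code [j g]; no set in [I] contains a whole fiber. *)
Lemma continuum_le_dominating (D : set (baire -> T)) :
  dominating R I D -> continuum #<= D.
Proof.
move=> Ddom; have [//|/(card_le_inj_on (fun=> true))[j jinj _]] :=
  card_le_total continuum D.
have [phi phiP] := large_fibers.
have /choice[f fP] z : exists y, forall g, D g -> j g = phi z -> ~ R y (g z).
  have [[g [Dg jg]]|n] := pselect (exists g, D g /\ j g = phi z).
    have [y yP] := R_evade (g z); exists y => g' Dg' jg'.
    by rewrite (jinj g' g) ?inE // jg jg'.
  by exists (fun=> 0) => g Dg jg; case: n; exists g.
have [g Dg fg] := Ddom f.
have [z zX zg] := phiP _ fg (j g).
by case: zX; exact: fP.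
Qed.

Lemma dominating_trivial (D : set (baire -> T)) : dominating R I D ->
  exists2 E, dominating R (trivial_ideal baire) E & E #<= D.
Proof.
move=> Ddom; have cD := continuum_le_dominating _ Ddom.
have [phi phiP] := large_fibers; have [e eI ecof] := cofinal_enum.
have [j jinj _] := card_le_inj_on (fun=> true) baire_card_le_continuum.
have /choice[r rP] c : exists x, forall y, j y = c -> x = y.
  have [[y <-]|n] := pselect (exists y, j y = c).
    by exists y => y' /jinj-> //; rewrite in_setT.
  by exists (fun=> 0) => y jy; case: n; exists y.
(* At [w (a, x)], a point outside [e a], the function [f \o r \o phi] takes the value [f x],
   whatever [f] is. *)
have /choice[w wP] ax : exists z, ~ e ax.1 z /\ r (phi z) = ax.2.
  have [z nz pz] := phiP _ (eI ax.1) (j ax.2); exists z; split=> //.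
  by rewrite pz; exact: rP.
exists ((fun ga x => ga.1 (w (ga.2, x))) @` (D `*` continuum)); last first.
  exact: card_le_trans (card_image_le _ _) (card_mul_continuum cD).
move=> f; have [g Dg fg] := Ddom (f \o r \o phi).
have [a Xa] := ecof _ fg.
exists (fun x => g (w (a, x))); first by exists (g, a).
apply/seteqP; split=> x //= nR.
have [nw rw] := wP (a, x); apply: nw; apply: Xa => /=.
by rewrite rw.
Qed.

Lemma dnum_eq_trivial : dnum R I #= dnum R (trivial_ideal baire).
Proof.
have [Idom Imin] := @dnumP _ R I I_ideal R_total.
have [tdom tmin] := @dnumP _ R _ (trivial_is_ideal baire) R_total.
rewrite card_eq_le; apply/andP; split.
  (* Capturing everywhere implies capturing modulo [I], since [I] contains the empty set. *)
  apply: Imin => f; have [g tg fg] := tdom f; exists g => //.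
  by move: fg; rewrite /rel_mod /trivial_ideal /= => ->; exact: ideal0.
have [E Edom ED] := dominating_trivial _ Idom.
exact: card_le_trans (tmin _ Edom) ED.
Qed.

End Ideal.

(** * Evasion for the three relations *)

Lemma almost_all_False (P : nat -> Prop) : (forall k, ~ P k) -> ~ almost_all P.
Proof.
move=> nP; rewrite /almost_all (_ : [set _ | _] = setT).
  exact: infinite_nat.
by apply/seteqP; split=> // k _; exact: nP.
Qed.

Lemma le_star_evade (y : baire) : exists x, ~ le_star x y.
Proof.
by exists (fun k => (y k).+1); apply: almost_all_False => k; rewrite ltnn.
Qed.

Lemma neq_star_evade (y : baire) : exists x, ~ neq_star x y.
Proof. by exists y; apply: almost_all_False => k; apply. Qed.

Lemma in_star_evade (s : slalom) : exists x, ~ in_star x s.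
Proof.
exists (fun k => (\max_(i <- sval s k) i).+1); apply: almost_all_False => k ks.
by have := @leq_bigmax_seq _ _ predT id _ ks isT; rewrite ltnn.
Qed.

Theorem theorem5p1 (I : set (set baire)) (I_ideal : is_ideal I)
    (cof_le : cof I #<= continuum)
    (compl_card : forall X : set baire, I X -> (~` X) #= continuum) :
  [/\ dnum in_star I #= dnum in_star (trivial_ideal baire),
      dnum le_star I #= dnum le_star (trivial_ideal baire) &
      dnum neq_star I #= dnum neq_star (trivial_ideal baire)].
Proof.
split; apply: dnum_eq_trivial => //.
- exact: in_star_ex.
- exact: in_star_evade.
- exact: le_star_ex.
- exact: le_star_evade.
- exact: neq_star_ex.
- exact: neq_star_evade.
Qed.
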